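(* Let $n\ge 1$, let $\mathbb{K}=\mathbb{R}$ or $\mathbb{C}$, and let $V$ be a vector space of dimension $n+1$ over $\mathbb{K}$ with basis $e^1,\dots,e^{n+1}$. For $Q\in S^2(\Lambda^2 V)$ let $g_Q$ denote the Monge metric of $Q$ in the affine chart $u^{n+1}=1$. Then $Q\mapsto g_Q$ is a one-to-one correspondence between (a) the elements $Q\in S^2(\Lambda^2V)$ of rank $n$ that belong to the kernel of the natural map $S^2(\Lambda^2V)\to\Lambda^4V$, $\ \omega\cdot\eta\mapsto\omega\wedge\eta$, and for which $\det\big((g_Q)_{ij}\big)$ is not identically zero; and (b) the Monge metrics $g=g_{ij}(u)\,du^idu^j$ (equivalently, the quadratic line complexes in $\mathbb{P}^n=\mathbb{P}(V)$, with a fixed normalisation of their equation) with $\det g_{ij}\not\equiv 0$ that correspond to $n$-component homogeneous third-order Hamiltonian operators $$J=D\left(g^{ij}D+c^{ij}_k u^k_x\right)D,$$ where $g^{ij}$ is the inverse matrix of $g_{ij}$.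
   Context: Monge metric. Write $Q=\sum Q_{ab,cd}\,(e^a\wedge e^b)\cdot(e^c\wedge e^d)$. Its Monge metric $g_Q$ is the quadratic form in $du^1,\dots,du^n$ (with coefficients polynomial in $u^1,\dots,u^n$) obtained by substituting $e^a\wedge e^b\mapsto p^{ab}:=u^adu^b-u^bdu^a$ ($1\le a,b\le n+1$) and then setting $u^{n+1}=1$, $du^{n+1}=0$. The quantities $p^{ab}$ are the Plücker coordinates of the line through infinitesimally close points $u$ and $u+du$. A quadratic line complex in $\mathbb{P}^n$ is the family of lines whose Plücker coordinates satisfy one additional quadratic equation. Such an equation is defined modulo the Plücker relations, and adding Plücker relations to $Q$ does not change $g_Q$. The class of all $g_Q$ is the class of metrics that are quadratic forms with constant coefficients in $du^i$ and $u^jdu^k-u^kdu^j$, $1\le i,j,k\le n$. The rank of $Q$ is its rank as a symmetric bilinear form on $(\Lambda^2V)^*$. Hamiltonian operators. $D=d/dx$ is the total $x$-derivative, $u=(u^1,\dots,u^n)$ are dependent variables, and $g^{ij},c^{ij}_k$ are functions of $u$ with $\det g^{ij}\ne0$. $J$ is Hamiltonian if the bracket $\{F,G\}=\int\frac{\delta F}{\delta u^i}J^{ij}\frac{\delta G}{\delta u^j}\,dx$ is skew-symmetric and satisfies the Jacobi identity. Let $g_{ij}$ be the inverse matrix of $g^{ij}$, and let $c_{ijk}=g_{iq}g_{jp}c^{pq}_k$. With a comma denoting partial derivative, the following characterisation is known and may be used as the definition: $J$ is Hamiltonian if and only if $g_{ij}$ is symmetric and $$g_{mn,k}=-c_{mnk}-c_{nmk},\quad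 c_{mnk}=-c_{mkn},\quad c_{mnk}+c_{nkm}+c_{kmn}=0,\quad c_{mnk,l}=-g^{pq}c_{pml}c_{qnk}.$$ These relations determine $c$ from $g$ via $c_{nkm}=\frac13(g_{nm,k}-g_{nk,m})$. A metric $g$ corresponds to a Hamiltonian operator if, with this $c$, all the relations hold on the set where $\det g_{ij}\neq0$. *)

(* Defs.v *)
From mathcomp Require Import all_boot all_order all_algebra.
From mathcomp Require Import complex.
From mathcomp Require Import mpoly.
From mathcomp Require Import boolp classical_sets functions reals.

Set Implicit Arguments.
Unset Strict Implicit.
Unset Printing Implicit Defensive.

Import GRing.Theory.

Local Open Scope classical_set_scope.
Local Open Scope ring_scope.

(* V = K^(n+1) with basis e^a, a : 'I_n.+1 (numbered from 0), so that ord_max  *)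
(* is the index of the coordinate normalised to 1 in the affine chart.         *)
(* The intended fields are the reals and the complex numbers; the definitions  *)
(* below divide by 2 and 3.                                                    *)

(* Exterior algebra of V: x S is the coefficient of e^(s_1) /\ .. /\ e^(s_k)   *)
(* where S = {s_1 < .. < s_k}.                                                 *)
Notation extalg K n := {ffun {set 'I_n.+1} -> K^o}.

Definition inversions (n : nat) (A B : {set 'I_n.+1}) : nat :=
  #|[pred p : 'I_n.+1 * 'I_n.+1 | [&& p.1 \in A, p.2 \in B & (p.2 < p.1)%N]]|.

Definition ext_basis (K : fieldType) (n : nat) (a : 'I_n.+1) :
    extalg K n :=
  [ffun S => (S == [set a]%SET)%:R].

Definition wedge (K : fieldType) (n : nat) (x y : extalg K n) :
    extalg K n :=
  [ffun S : {set 'I_n.+1} =>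
     \sum_(A in powerset S)
       (-1) ^+ inversions A (S :\: A) * x A * y (S :\: A)].

(* Lambda^2 V has the basis e^a /\ e^b, a < b; its elements are given by their *)
(* row of coordinates, and the elements of S^2(Lambda^2 V) by the symmetric    *)
(* matrix (Q_{ab,cd}) of their coefficients, which is also the matrix of the   *)
(* corresponding symmetric bilinear form on the dual of Lambda^2 V.            *)
Definition pairs (n : nat) : finType :=
  {p : 'I_n.+1 * 'I_n.+1 | (p.1 < p.2)%N}.

Definition pair1 (n : nat) (i : 'I_#|pairs n|) : 'I_n.+1 := (val (enum_val i)).1.
Definition pair2 (n : nat) (i : 'I_#|pairs n|) : 'I_n.+1 := (val (enum_val i)).2.

(* The natural map S^2(Lambda^2 V) -> Lambda^4 V, w . h |-> w /\ h.            *)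
Definition wedge_map (K : fieldType) (n : nat) (Q : 'M[K]_#|pairs n|) :
    extalg K n :=
  \sum_(i < #|pairs n|) \sum_(j < #|pairs n|)
    Q i j *: wedge (wedge (ext_basis K (pair1 i)) (ext_basis K (pair2 i)))
                   (wedge (ext_basis K (pair1 j)) (ext_basis K (pair2 j))).

(* Homogeneous coordinates u^a and their differentials in the chart            *)
(* u^(n+1) = 1; a 1-form is the row of its coefficients on du^1, .., du^n.     *)
Definition hcoord (K : fieldType) (n : nat) (a : 'I_n.+1) : {mpoly K[n]} :=
  if unlift ord_max a is Some i then 'X_i else 1.

Definition dhcoord (K : fieldType) (n : nat) (a : 'I_n.+1) :
    'rV[{mpoly K[n]}]_n :=
  if unlift ord_max a is Some i then delta_mx 0 i else 0.

Definition plucker_form (K : fieldType) (n : nat) (a b : 'I_n.+1) :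
    'rV[{mpoly K[n]}]_n :=
  hcoord K a *: dhcoord K b - hcoord K b *: dhcoord K a.

(* A quadratic form in du^1, .., du^n is given by its matrix (g_ij).           *)
Definition monge_metric (K : fieldType) (n : nat) (Q : 'M[K]_#|pairs n|) :
    'M[{mpoly K[n]}]_n :=
  \sum_(i < #|pairs n|) \sum_(j < #|pairs n|)
    (Q i j)%:MP *: ((plucker_form K (pair1 i) (pair2 i))^T
                      *m plucker_form K (pair1 j) (pair2 j)).

Definition is_monge_metric (K : fieldType) (n : nat)
    (g : 'M[{mpoly K[n]}]_n) : Prop :=
  exists2 Q : 'M[K]_#|pairs n|, Q^T = Q & g = monge_metric Q.

(* The relations between g_ij and c_ijk (both with lower indices) that         *)
(* characterise Hamiltonian operators, on the set where det g_ij does not      *)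
(* vanish.  The matrix ginv is (g^ij) at the point u.                          *)
Definition hamiltonian (K : fieldType) (n : nat) (g : 'M[{mpoly K[n]}]_n)
    (c : 'I_n -> 'I_n -> 'I_n -> {mpoly K[n]}) : Prop :=
  forall u : 'I_n -> K, (\det g).@[u] != 0 ->
  let ginv := invmx (map_mx (meval u) g) in
  [/\ forall i j, (g i j).@[u] = (g j i).@[u],
      forall m p k, (g m p)^`M(k).@[u] = - (c m p k).@[u] - (c p m k).@[u],
      forall m p k, (c m p k).@[u] = - (c m k p).@[u],
      forall m p k, (c m p k).@[u] + (c p k m).@[u] + (c k m p).@[u] = 0
    & forall m n' k l, (c m n' k)^`M(l).@[u] =
        - \sum_(p < n) \sum_(q < n)
            ginv p q * (c p m l).@[u] * (c q n' k).@[u]].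

Definition metric_c (K : fieldType) (n : nat) (g : 'M[{mpoly K[n]}]_n)
    (i k m : 'I_n) : {mpoly K[n]} :=
  3%:R^-1 *: ((g i m)^`M(k) - (g i k)^`M(m)).

Definition hamiltonian_metric (K : fieldType) (n : nat)
    (g : 'M[{mpoly K[n]}]_n) : Prop :=
  hamiltonian g (metric_c g).

(* Quadratic line complexes.  The normalised equation of a complex is a        *)
(* quadratic form in Plucker coordinates modulo the Plucker relations, i.e. a  *)
(* coset of their span in S^2(Lambda^2 V).                                     *)
Definition bivector (K : fieldType) (n : nat) (a b : 'I_n.+1) :
    'rV[K]_#|pairs n| :=
  \row_i (((pair1 i == a) && (pair2 i == b))%:R
          - ((pair1 i == b) && (pair2 i == a))%:R).

Definition sym_prod (K : fieldType) (n : nat) (w h : 'rV[K]_#|pairs n|) :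
    'M[K]_#|pairs n| :=
  2%:R^-1 *: (w^T *m h + h^T *m w).

Definition plucker_relation (K : fieldType) (n : nat) (a b c d : 'I_n.+1) :
    'M[K]_#|pairs n| :=
  sym_prod (bivector K a b) (bivector K c d)
  - sym_prod (bivector K a c) (bivector K b d)
  + sym_prod (bivector K a d) (bivector K b c).

Definition plucker_span (K : fieldType) (n : nat) :
    {vspace 'M[K]_#|pairs n|} :=
  <<[seq plucker_relation K x.1.1 x.1.2 x.2.1 x.2.2
    | x : ('I_n.+1 * 'I_n.+1) * ('I_n.+1 * 'I_n.+1)]>>%VS.

Definition line_complex (K : fieldType) (n : nat) (Q : 'M[K]_#|pairs n|) :
    set 'M[K]_#|pairs n| :=
  [set Q' | Q'^T = Q' /\ Q' - Q \in plucker_span K n].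

Definition nondeg_wedge_kernel_rank_n (K : fieldType) (n : nat) :
    set 'M[K]_#|pairs n| :=
  [set Q | [/\ Q^T = Q, \rank Q = n, wedge_map Q = 0
             & \det (monge_metric Q) != 0]].

Definition hamiltonian_monge_metrics (K : fieldType) (n : nat) :
    set 'M[{mpoly K[n]}]_n :=
  [set g | [/\ is_monge_metric g, \det g != 0 & hamiltonian_metric g]].

Definition hamiltonian_line_complexes (K : fieldType) (n : nat) :
    set (set 'M[K]_#|pairs n|) :=
  [set C | exists Q : 'M[K]_#|pairs n|,
     [/\ Q^T = Q, C = line_complex Q, \det (monge_metric Q) != 0
       & hamiltonian_metric (monge_metric Q)]].

(* Main.v *)
Require Import Defs.
From mathcomp Require Import all_boot all_order all_algebra.
From mathcomp Require Import complex.
From mathcomp Require Import mpoly.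
From mathcomp Require Import boolp classical_sets functions reals.
From mathcomp Require Import ring.

(* Write <x, y> for the bilinear form of Q and psi_k(u) for the bivector      *)
(* u /\ e_k, so that g_kl = <psi_k, psi_l>, and A_lk = d psi_k / d u^l =      *)
(* e_l /\ e_k is constant.  Q is in the kernel of the wedge map iff           *)
(* <a/\b, c/\d> satisfies the Bianchi identity.  Subtracting from Q a third   *)
(* of a combination of Plucker relations enforces this identity without       *)
(* changing g_Q, and Q is then determined by g_Q: the second derivatives of   *)
(* g_Q = 0 together with Bianchi make <A, A> vanish, and similarly for the    *)
(* remaining coefficients.                                                    *)
(* For Q satisfying Bianchi, c_nkm = <psi_n, A_km> and                        *)
(* c_mnk,l = <A_lm, A_nk>, so the quadratic relation on c says that           *)
(* <A_lm, A_nk> = g^pq <A_lm, psi_p> <psi_q, A_nk>.  Where det g <> 0 the     *)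
(* difference of the two sides, extended to a form on all of K^(pairs), is    *)
(* killed by the psi_p; as the psi's and A's span, the relation reads         *)
(* Q = Q psi^T g^-1 psi Q, which for invertible g = psi Q psi^T means         *)
(* rank Q = n.                                                                *)

Set Implicit Arguments.
Unset Strict Implicit.
Unset Printing Implicit Defensive.

Import GRing.Theory.

Local Open Scope ring_scope.

(** A symmetric [Q] is read as a form [bil Q] on bivectors, and [monge_metric Q] at [u] is the Gram
    matrix of that form on the bivectors u /\ e_k, the [line_vec u k]. Two independent facts
    combine.

    Each class of symmetric forms modulo Plücker relations contains exactly one form killed by the
    wedge map, that is, satisfying [bianchi] ([wedge_map_eq0]). Existence is [bianchi_projP] with
    [bianchi_proj_span]. Uniqueness holds because the metric sees only the class
    ([monge_plucker_span]) and determines a Bianchi form ([monge_metric_inj0]). So metrics,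
    complexes and Bianchi forms are the same data.

    For a Bianchi form the linear Hamiltonian relations are automatic, and the quadratic one says
    that [Q] is recovered from its restriction to the n-dimensional span of the [line_vec u k] by
    orthogonal projection ([hamiltonian_metricP]). The complement of that span is then the radical
    of [Q], which means rank n ([rank_gram]). *)

Definition ext_mono (K : fieldType) (n : nat) (A : {set 'I_n.+1}) : extalg K n :=
  [ffun S => (S == A)%:R].

(** * Products of basis vectors in the exterior algebra *)

Section Wedge.
Variables (K : fieldType) (n : nat).
Implicit Types (a b c d p q r s : 'I_n.+1) (A B S : {set 'I_n.+1}).

Lemma ext_monoE A S : ext_mono K A S = (S == A)%:R.
Proof. exact: ffunE. Qed.

(** In the sum over subsets of [S] only the term indexed by [A] can survive, and it does so exactly
    when [S] is the disjoint union of [A] and [B]. *)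
Lemma wedge_mono A B :
  wedge (ext_mono K A) (ext_mono K B) =
  if [disjoint A & B] then (-1) ^+ inversions A B *: ext_mono K (A :|: B) else 0.
Proof.
apply/ffunP => S; rewrite ffunE.
have [disjAB|meetAB] := boolP [disjoint A & B].
  rewrite ffunE ext_monoE; have [->|neS] := eqVneq S (A :|: B).
    rewrite (bigD1 A) ?powersetE ?finset.subsetUl //= !ext_monoE.
    have -> : (A :|: B) :\: A = B.
      apply/setP => x; rewrite !inE; have [xA|//] := boolP (x \in A).
      by rewrite (disjointFr disjAB xA).
    rewrite !eqxx !mulr1 big1 ?addr0 ?[_ *: _]mulr1 // => C /andP[_ neC].
    by rewrite ext_monoE (negbTE neC) mulr0 mul0r.
  rewrite [_ *: _]mulr0 big1 // => C; rewrite powersetE => sCS.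
  rewrite !ext_monoE; have [eqC|] := eqVneq C A; last by rewrite mulr0 mul0r.
  have [eqD|] := eqVneq (S :\: C) B; last by rewrite mulr0.
  case/eqP: neS; rewrite -eqC -eqD.
  by apply/setP => x; rewrite !inE;
    case: (boolP (x \in C)) => //= /(fintype.subsetP sCS).
rewrite ffunE big1 // => C _.
rewrite !ext_monoE; have [eqC|] := eqVneq C A; last by rewrite mulr0 mul0r.
have [eqD|] := eqVneq (S :\: C) B; last by rewrite mulr0.
move: meetAB; rewrite -eqC -eqD -setI_eq0; case/negP; apply/eqP/setP => x.
by rewrite !inE andbA andbN.
Qed.

Lemma inversions_sum A B :
  inversions A B = (\sum_(x in A) \sum_(y in B) (y < x)%N)%N.
Proof.
rewrite /inversions -sum1_card pair_big_dep /= big_mkcond [RHS]big_mkcond /=.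
apply: eq_bigr => -[x y] _ /=; rewrite inE /=.
by case: (x \in A); case: (y \in B); case: (y < x)%N.
Qed.

Lemma wedge_basis a b : (a < b)%N ->
  wedge (ext_basis K a) (ext_basis K b) = ext_mono K [set a; b]%SET.
Proof.
move=> ltab; rewrite [LHS]wedge_mono disjoints1 finset.in_set1 inversions_sum.
rewrite !big_set1 ltnNge ltnW //= scale1r.
by rewrite -val_eqE /= neq_ltn ltab.
Qed.

Lemma wedge_basis4 a b c d : (a < b)%N -> (c < d)%N ->
  wedge (wedge (ext_basis K a) (ext_basis K b))
        (wedge (ext_basis K c) (ext_basis K d)) =
  if [disjoint [set a; b]%SET & [set c; d]%SET] then
    (-1) ^+ ((c < a) + (d < a) + ((c < b) + (d < b)))
      *: ext_mono K ([set a; b] :|: [set c; d])%SET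
  else 0.
Proof.
move=> ltab ltcd; rewrite !wedge_basis // wedge_mono inversions_sum.
have neab : a \notin [set b]%SET by rewrite finset.in_set1 -val_eqE /= neq_ltn ltab.
have necd : c \notin [set d]%SET by rewrite finset.in_set1 -val_eqE /= neq_ltn ltcd.
by rewrite !big_setU1 //= !big_set1 !big_setU1 //= !big_set1.
Qed.

Lemma disjoint_set2 a b c d : [disjoint [set a; b]%SET & [set c; d]%SET] =
  [&& a != c, a != d, b != c & b != d].
Proof.
by rewrite finset.disjoints_subset finset.subUset !finset.sub1set !inE !negb_or
  -andbA.
Qed.

Let delta4 a b c d p q r s : K :=
  ((a == p) && (b == q))%:R * ((c == r) && (d == s))%:R.

(** The six terms are the ways to split p < q < r < s into two increasing pairs, each with the sign
    of its shuffle. *)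
Lemma wedge_basis4_coef a b c d p q r s : (a < b)%N -> (c < d)%N ->
  (p < q)%N -> (q < r)%N -> (r < s)%N ->
  wedge (wedge (ext_basis K a) (ext_basis K b))
        (wedge (ext_basis K c) (ext_basis K d)) [set p; q; r; s]%SET =
  delta4 a b c d p q r s + delta4 a b c d r s p q
  - delta4 a b c d p r q s - delta4 a b c d q s p r
  + delta4 a b c d p s q r + delta4 a b c d q r p s.
Proof.
move=> ltab ltcd ltpq ltqr ltrs; rewrite wedge_basis4 // disjoint_set2.
set S := [set p; q; r; s]%SET.
have ne (x y : 'I_n.+1) : (x < y)%N -> (x == y) = false.
  by move=> lt; rewrite -val_eqE /= ltn_eqF.
have ltpr := ltn_trans ltpq ltqr; have ltqs := ltn_trans ltqr ltrs.
have ltps := ltn_trans ltpq ltqs.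
have ned := (ne _ _ ltpq, ne _ _ ltpr, ne _ _ ltps, ne _ _ ltqr, ne _ _ ltqs,
  ne _ _ ltrs).
have ned' := (eq_sym q p, eq_sym r p, eq_sym s p, eq_sym r q, eq_sym s q,
  eq_sym s r).
have gtf (x y : 'I_n.+1) : (x < y)%N -> (y < x)%N = false.
  by move=> lt; rewrite ltnNge ltnW.
have lts := (ltpq, ltpr, ltps, ltqr, ltqs, ltrs, ltnn).
have gts := (gtf _ _ ltpq, gtf _ _ ltpr, gtf _ _ ltps, gtf _ _ ltqr,
  gtf _ _ ltqs, gtf _ _ ltrs).
have out (x : 'I_n.+1) : x \notin S ->
    [/\ (x == p) = false, (x == q) = false, (x == r) = false & (x == s) = false].
  rewrite !inE !negb_or -!andbA.
  by case/and4P => /negbTE-> /negbTE-> /negbTE-> /negbTE->.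
have notS (x : 'I_n.+1) : x \in [set a; b]%SET :|: [set c; d]%SET -> x \notin S ->
    S == [set a; b]%SET :|: [set c; d]%SET = false.
  by move=> xU xS; apply: contraNF xS => /eqP->.
have zeroS (x : 'I_n.+1) :
    x \in [set a; b]%SET :|: [set c; d]%SET -> x \notin S ->
    (if [&& a != c, a != d, b != c & b != d]
     then (-1) ^+ ((c < a) + (d < a) + ((c < b) + (d < b)))
          *: ext_mono K ([set a; b] :|: [set c; d])%SET else 0) S = 0.
  move=> xU xS; case: ifP => _; rewrite ffunE //.
  by rewrite ext_monoE (notS x xU xS) [_ *: _]mulr0.
have inS (x : 'I_n.+1) : x \in S -> [\/ x = p, x = q, x = r | x = s].
  by rewrite !inE -!orbA => /or4P[] /eqP->;
    [constructor 1|constructor 2|constructor 3|constructor 4].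
(* An index outside [S] makes both sides vanish, so all four may be taken in [S]. *)
have [aS|aS] := boolP (a \in S); last first.
  by rewrite (zeroS a) ?inE ?eqxx // /delta4; case: (out _ aS) => e1 e2 e3 e4;
    rewrite !(e1, e2, e3, e4) /=; ring.
have [bS|bS] := boolP (b \in S); last first.
  by rewrite (zeroS b) ?inE ?eqxx ?orbT // /delta4;
    case: (out _ bS) => e1 e2 e3 e4; rewrite !(e1, e2, e3, e4, andbF) /=; ring.
have [cS|cS] := boolP (c \in S); last first.
  by rewrite (zeroS c) ?inE ?eqxx ?orbT // /delta4;
    case: (out _ cS) => e1 e2 e3 e4; rewrite !(e1, e2, e3, e4) /=; ring.
have [dS|dS] := boolP (d \in S); last first.
  by rewrite (zeroS d) ?inE ?eqxx ?orbT // /delta4;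
    case: (out _ dS) => e1 e2 e3 e4; rewrite !(e1, e2, e3, e4, andbF) /=; ring.
have Sp (A : {set 'I_n.+1}) : p \in A -> q \in A -> r \in A -> s \in A ->
    A \subset S -> S == A.
  move=> pA qA rA sA AS; rewrite finset.eqEsubset AS andbT.
  by apply/fintype.subsetP => x /inS[] ->.
clear zeroS notS out.
(* Only the 36 placements of a < b and c < d in {p, q, r, s} survive. *)
case: (inS _ aS) ltab => -> ltab; case: (inS _ bS) ltab => -> ltab;
  rewrite ?(lts, gts) // in ltab => {aS bS ltab};
case: (inS _ cS) ltcd => -> ltcd; case: (inS _ dS) ltcd => -> ltcd;
  rewrite ?(lts, gts) // in ltcd => {cS dS ltcd};
rewrite /delta4 ?ned' ?ned ?eqxx ?ned /= ?ffunE ?lts ?gts /=.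
all: try by ring.
all: rewrite Sp ?inE ?eqxx ?orbT //; last
  (by apply/fintype.subsetP => x; rewrite !inE -!orbA => /or4P[] ->; rewrite ?orbT).
all: try by rewrite [_ *: _]mulr1; ring.
Qed.
End Wedge.

(** * The bilinear form of [Q], the Bianchi identity and the Plücker relations *)

Section Polar.
Variables (K : fieldType) (n : nat).
Implicit Types (a b c d p q r s : 'I_n.+1) (Q : 'M[K]_#|pairs n|).
Implicit Types (x y w h : 'rV[K]_#|pairs n|).
Local Notation biv := (bivector K).

Definition bil Q x y : K := (x *m Q *m y^T) 0 0.

Lemma bilE Q x y : bil Q x y = \sum_i \sum_j Q i j * (x 0 i * y 0 j).
Proof.
rewrite /bil mxE exchange_big /=; apply: eq_bigr => j _.
rewrite !mxE mulr_suml; apply: eq_bigr => i _; ring.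
Qed.

Lemma bilC Q x y : Q^T = Q -> bil Q x y = bil Q y x.
Proof.
move=> symQ; have eqT : (x *m Q *m y^T)^T = y *m Q *m x^T.
  by rewrite !trmx_mul trmxK symQ mulmxA.
by rewrite /bil -eqT [RHS]mxE.
Qed.

Lemma bilNl Q x y : bil Q (- x) y = - bil Q x y.
Proof. by rewrite /bil !mulNmx mxE. Qed.

Lemma bilNr Q x y : bil Q x (- y) = - bil Q x y.
Proof. by rewrite /bil raddfN /= mulmxN mxE. Qed.

Lemma bilDm Q Q' x y : bil (Q + Q') x y = bil Q x y + bil Q' x y.
Proof. by rewrite /bil mulmxDr mulmxDl mxE. Qed.

Lemma bilZm k Q x y : bil (k *: Q) x y = k * bil Q x y.
Proof. by rewrite /bil -scalemxAr -scalemxAl mxE. Qed.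

Lemma bil_suml Q I (r : seq I) (F : I -> K) (X : I -> 'rV_#|pairs n|) y :
  bil Q (\sum_(i <- r) F i *: X i) y = \sum_(i <- r) F i * bil Q (X i) y.
Proof.
rewrite /bil !mulmx_suml summxE; apply: eq_bigr => i _.
by rewrite -!scalemxAl mxE.
Qed.

Lemma pair_lt (i : 'I_#|pairs n|) : (pair1 i < pair2 i)%N.
Proof. exact: valP (enum_val i). Qed.

Lemma pair_inj (i j : 'I_#|pairs n|) :
  pair1 i = pair1 j -> pair2 i = pair2 j -> i = j.
Proof.
rewrite /pair1 /pair2 => e1 e2; apply: enum_val_inj; apply: val_inj.
by rewrite [LHS]surjective_pairing e1 e2 -surjective_pairing.
Qed.

Lemma bivectorN a b : biv a b = - biv b a.
Proof. by apply/rowP => i; rewrite !mxE opprB. Qed.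

Lemma bivector_lt a b (i : 'I_#|pairs n|) : (a < b)%N ->
  biv a b 0 i = ((pair1 i == a) && (pair2 i == b))%:R.
Proof.
move=> ltab; rewrite mxE; case: (boolP (_ && _)) => [|_]; last first.
  case: andP => [[/eqP eb /eqP ea]|]; last by rewrite subr0.
  by have := pair_lt i; rewrite ea eb ltnNge ltnW.
case/andP => /eqP-> /eqP->; rewrite -[a == b]val_eqE /= ltn_eqF //=.
by rewrite subr0.
Qed.

Lemma bivector_pair (i : 'I_#|pairs n|) : biv (pair1 i) (pair2 i) = delta_mx 0 i.
Proof.
apply/rowP => j; rewrite bivector_lt ?pair_lt // !mxE eqxx /=; congr _%:R.
congr nat_of_bool; apply/andP/eqP => [[/eqP e1 /eqP e2]|->]; last by [].
exact: pair_inj.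
Qed.

Lemma bivector_dot a b c d :
  (biv a b *m (biv c d)^T) 0 0 =
  (a == c)%:R * (b == d)%:R - (a == d)%:R * (b == c)%:R.
Proof.
wlog ltab : a b / (a < b)%N => [IH|].
  have [/IH//|ltba|/val_inj->] := ltngtP a b.
    by rewrite bivectorN mulNmx mxE IH //; ring.
  have -> : biv b b = 0 by apply/rowP => i; rewrite !mxE subrr.
  by rewrite mul0mx mxE; ring.
pose i : 'I_#|pairs n| := enum_rank (exist _ (a, b) ltab : pairs n).
have [<- <-] : pair1 i = a /\ pair2 i = b by rewrite /pair1 /pair2 enum_rankK.
rewrite bivector_pair -rowE !mxE -!mulnb !natrM; ring.
Qed.

Lemma bil_sym_prod w h x y :
  bil (sym_prod w h) x y =
  2%:R^-1 * ((x *m w^T) 0 0 * (y *m h^T) 0 0 + (x *m h^T) 0 0 * (y *m w^T) 0 0).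
Proof.
have tr (z z' : 'rV[K]_#|pairs n|) : z *m z'^T = ((z' *m z^T) 0 0)%:M.
  have eqT : (z' *m z^T)^T = z *m z'^T by rewrite trmx_mul trmxK.
  by rewrite [LHS]mx11_scalar -eqT [X in X%:M]mxE.
rewrite /bil /sym_prod -scalemxAr -scalemxAl mulmxDr mulmxDl !mulmxA.
rewrite mxE [X in _ * X]mxE; congr (_ * (_ + _)).
  by rewrite -(mulmxA _ h) [h *m _]tr mul_mx_scalar mxE mulrC.
by rewrite -(mulmxA _ w) [w *m _]tr mul_mx_scalar mxE mulrC.
Qed.

(** The sum in the algebraic Bianchi identity for the curvature-like tensor R_abcd = <e_a /\ e_b,
    e_c /\ e_d>. *)
Definition cyc Q a b c d : K :=
  bil Q (biv a b) (biv c d) + bil Q (biv a c) (biv d b) + bil Q (biv a d) (biv b c).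

Lemma cycD Q Q' a b c d : cyc (Q + Q') a b c d = cyc Q a b c d + cyc Q' a b c d.
Proof. by rewrite /cyc !bilDm; ring. Qed.

Lemma cycZ k Q a b c d : cyc (k *: Q) a b c d = k * cyc Q a b c d.
Proof. by rewrite /cyc !bilZm; ring. Qed.

Lemma cyc_sum I (r : seq I) (F : I -> 'M[K]_#|pairs n|) a b c d :
  cyc (\sum_(i <- r) F i) a b c d = \sum_(i <- r) cyc (F i) a b c d.
Proof.
apply: (big_morph (fun Q => cyc Q a b c d)) => [Q Q'|]; first exact: cycD.
by rewrite -[0](scale0r 0) cycZ mul0r.
Qed.

(** Symmetry of [Q] identifies the six shuffles two by two, whence the factor 2. *)
Lemma wedge_map_coef Q p q r s : Q^T = Q ->
  (p < q)%N -> (q < r)%N -> (r < s)%N ->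
  wedge_map Q [set p; q; r; s]%SET = cyc Q p q r s *+ 2.
Proof.
move=> symQ ltpq ltqr ltrs.
have ltpr := ltn_trans ltpq ltqr; have ltqs := ltn_trans ltqr ltrs.
have ltps := ltn_trans ltpq ltqs.
transitivity (bil Q (biv p q) (biv r s) + bil Q (biv r s) (biv p q)
  - bil Q (biv p r) (biv q s) - bil Q (biv q s) (biv p r)
  + bil Q (biv p s) (biv q r) + bil Q (biv q r) (biv p s)).
  rewrite !bilE /wedge_map -!sumrN -!big_split sum_ffunE /=.
  apply: eq_bigr => i _; rewrite -!sumrN -!big_split sum_ffunE /=.
  apply: eq_bigr => j _.
  rewrite ffunE wedge_basis4_coef ?pair_lt // !bivector_lt //.
  by rewrite /GRing.scale /=; ring.
rewrite ![bil Q (biv r s) _]bilC // ![bil Q (biv q s) _]bilC //.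
rewrite ![bil Q (biv q r) _]bilC //.
by rewrite /cyc [biv s q]bivectorN bilNr; ring.
Qed.

Lemma card4_set (S : {set 'I_n.+1}) : #|S| = 4%N ->
  exists p, exists q, exists r, exists s,
    [/\ (p < q)%N, (q < r)%N, (r < s)%N & S = [set p; q; r; s]%SET].
Proof.
rewrite cardE => cardS.
have : sorted (fun i j : 'I_n.+1 => (i < j)%N) (enum S).
  rewrite /enum_mem; apply: sorted_filter; first by move=> ? ? ?; apply: ltn_trans.
  rewrite -enumT -(@sorted_map _ _ val ltn) val_enum_ord; exact: iota_ltn_sorted.
case eS: (enum S) cardS => [|p [|q [|r [|s []]]]] //= _ /and4P[pq qr rs _].
exists p, q, r, s; split => //.
by apply/setP => x; rewrite -mem_enum eS !inE !orbA.
Qed.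

Lemma cyc_swap12 Q a b c d : Q^T = Q -> cyc Q b a c d = - cyc Q a b c d.
Proof.
move=> symQ; rewrite /cyc [biv b a]bivectorN bilNl.
rewrite [bil Q (biv b c) _]bilC // [bil Q (biv b d) _]bilC //.
by rewrite [biv d a]bivectorN [biv d b]bivectorN bilNr bilNl; ring.
Qed.

Lemma cyc_swap23 Q a b c d : cyc Q a c b d = - cyc Q a b c d.
Proof.
by rewrite /cyc [biv b d]bivectorN [biv d c]bivectorN [biv c b]bivectorN
  !bilNr; ring.
Qed.

Lemma cyc_swap34 Q a b c d : cyc Q a b d c = - cyc Q a b c d.
Proof.
by rewrite /cyc [biv d c]bivectorN [biv c b]bivectorN [biv b d]bivectorN
  !bilNr; ring.
Qed.

Definition bianchi Q := forall a b c d, cyc Q a b c d = 0.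

(** The adjacent transpositions change the sign of [cyc]. As 2 is invertible, [cyc] is alternating,
    and its arguments may be sorted. *)
Lemma bianchi_sorted Q : Q^T = Q -> 2%:R != 0 :> K ->
  (forall a b c d, (a < b)%N -> (b < c)%N -> (c < d)%N -> cyc Q a b c d = 0) ->
  bianchi Q.
Proof.
move=> symQ nz2 sorted0.
have opp0 (z : K) : z = - z -> z = 0.
  move=> e; apply/eqP; have : z * 2%:R == 0 by rewrite mulr_natr mulr2n {1}e addNr.
  by rewrite mulf_eq0 (negbTE nz2) orbF.
have eqx a b c d : cyc Q b a c d = 0 -> cyc Q a b c d = 0.
  by rewrite cyc_swap12 // => /eqP; rewrite oppr_eq0 => /eqP.
have eqy a b c d : cyc Q a c b d = 0 -> cyc Q a b c d = 0.
  by rewrite cyc_swap23 // => /eqP; rewrite oppr_eq0 => /eqP.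
have eqz a b c d : cyc Q a b d c = 0 -> cyc Q a b c d = 0.
  by rewrite cyc_swap34 // => /eqP; rewrite oppr_eq0 => /eqP.
have aab a b c : cyc Q a a b c = 0 by apply: opp0; exact: cyc_swap12.
have abb a b c : cyc Q a b b c = 0 by apply: opp0; exact: cyc_swap23.
move=> a b c d.
wlog ltab : a b / (a < b)%N => [IH|].
  have [/IH//|ltba|/val_inj->] := ltngtP a b; last exact: aab.
  by apply: eqx; apply: IH.
wlog ltcd : c d / (c < d)%N => [IH|].
  have [/IH//|ltba|/val_inj->] := ltngtP c d; first by apply: eqz; apply: IH.
  by apply: opp0; exact: cyc_swap34.
wlog ltac : a b c d ltab ltcd / (a < c)%N => [IH|].
  have [ltac|ltca|/val_inj->] := ltngtP a c; first exact: IH.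
    (* These four transpositions exchange the pair [a], [b] with the pair [c], [d]. *)
    by apply/eqy/eqx/eqz/eqy/IH.
  by apply/eqy/aab.
have [ltbc|ltcb|/val_inj->] := ltngtP b c; [exact: sorted0| |exact: abb].
apply: eqy; have [ltbd|ltdb|/val_inj->] := ltngtP b d; first exact: sorted0.
  by apply/eqz/sorted0.
by apply: opp0; exact: cyc_swap34.
Qed.

Lemma wedge_map_eq0 Q : Q^T = Q -> 2%:R != 0 :> K ->
  wedge_map Q = 0 <-> bianchi Q.
Proof.
move=> symQ nz2; split => [W0|B].
  apply: bianchi_sorted => // a b c d ltab ltbc ltcd.
  have := wedge_map_coef symQ ltab ltbc ltcd; rewrite W0 ffunE => /esym/eqP.
  by rewrite -mulr_natr mulf_eq0 (negbTE nz2) orbF => /eqP.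
apply/ffunP => S; rewrite ffunE.
have [/eqP/card4_set[p [q [r [s [pq qr rs ->]]]]]|cardS] := boolP (#|S| == 4%N).
  by rewrite wedge_map_coef // B mul0rn.
(* Two disjoint pairs unite to four indices, so no product contributes to a set of another size. *)
rewrite sum_ffunE big1 // => i _; rewrite sum_ffunE big1 // => j _.
rewrite ffunE wedge_basis4 ?pair_lt //; case: ifP => [disj|_]; last first.
  by rewrite ffunE [_ *: _]mulr0.
rewrite ffunE ext_monoE; case: eqP => [eS|_]; last first.
  by rewrite [X in _ *: X]mulr0 [_ *: _]mulr0.
exfalso; move/negP: cardS; apply; have := disj; rewrite -leq_card_setU eS => /eqP->.
have neq k : pair1 k != pair2 k :> 'I_n.+1 by rewrite neq_ltn pair_lt.
by rewrite !cards2 !neq.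
Qed.

(** On symmetric forms this moves along the Plücker span to a Bianchi form; the factor 1/3
    compensates the 3 of [cyc_plucker_relation]. *)
Definition bianchi_proj Q : 'M[K]_#|pairs n| :=
  Q - 3%:R^-1 *: \sum_i \sum_j
    Q i j *: plucker_relation K (pair1 i) (pair2 i) (pair1 j) (pair2 j).

Lemma sym_prod_tr w h : (sym_prod w h)^T = sym_prod w h.
Proof. by rewrite /sym_prod linearZ linearD /= !trmx_mul !trmxK addrC. Qed.

Lemma plucker_relation_tr p q r s :
  (plucker_relation K p q r s)^T = plucker_relation K p q r s.
Proof. by rewrite /plucker_relation !linearD linearN /= !sym_prod_tr. Qed.

Lemma bianchi_proj_tr Q : Q^T = Q -> (bianchi_proj Q)^T = bianchi_proj Q.
Proof.
move=> symQ; rewrite /bianchi_proj linearB linearZ /= symQ; congr (_ - _ *: _).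
rewrite linear_sum; apply: eq_bigr => i _; rewrite linear_sum;
  apply: eq_bigr => j _.
by rewrite linearZ /= plucker_relation_tr.
Qed.

(** The three signed products in a Plücker relation have the same image e_p /\ e_q /\ e_r /\ e_s
    under the wedge map, and [cyc] depends on that image alone. *)
Lemma cyc_plucker_relation p q r s a b c d :
  cyc (plucker_relation K p q r s) a b c d =
  3%:R * cyc (sym_prod (biv p q) (biv r s)) a b c d.
Proof.
rewrite /plucker_relation !cycD -[- sym_prod _ _]scaleN1r [cyc (-1 *: _) _ _ _
  _]cycZ.
rewrite /cyc !bil_sym_prod !bivector_dot; ring.
Qed.

Lemma sum_sym_prod_pair Q : Q^T = Q -> 2%:R != 0 :> K ->
  \sum_i \sum_j Q i j *:
    sym_prod (biv (pair1 i) (pair2 i)) (biv (pair1 j) (pair2 j)) = Q.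
Proof.
move=> symQ nz2; rewrite [RHS]matrix_sum_delta.
have eQ : \sum_i \sum_j Q i j *: delta_mx j i = Q.
  rewrite exchange_big [RHS]matrix_sum_delta; apply: eq_bigr => i _.
  by apply: eq_bigr => j _; rewrite -[in LHS]symQ mxE.
transitivity (2%:R^-1 *: (Q + Q)); last first.
  by rewrite -mulr2n -scaler_nat scalerA mulVf // scale1r -matrix_sum_delta.
rewrite [in X in _ + X](matrix_sum_delta Q) -[in X in X + _]eQ.
rewrite -big_split scaler_sumr; apply: eq_bigr => i _.
rewrite -big_split scaler_sumr; apply: eq_bigr => j _ /=.
rewrite !bivector_pair /sym_prod !trmx_delta !mul_delta_mx.
by rewrite -scalerDr !scalerA mulrC addrC.
Qed.

Lemma bianchi_projP Q : Q^T = Q -> 2%:R != 0 :> K -> 3%:R != 0 :> K ->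
  bianchi (bianchi_proj Q).
Proof.
move=> symQ nz2 nz3 a b c d.
rewrite /bianchi_proj -scaleNr cycD cycZ cyc_sum.
transitivity (cyc Q a b c d - cyc Q a b c d); last exact: subrr.
congr (_ + _); rewrite -[in RHS](sum_sym_prod_pair symQ nz2) cyc_sum.
rewrite -sumrN mulr_sumr; apply: eq_bigr => i _.
rewrite !cyc_sum -sumrN mulr_sumr; apply: eq_bigr => j _.
rewrite [LHS]mulNr; congr (- _).
by rewrite cycZ cyc_plucker_relation mulrCA mulKf // [RHS]cycZ.
Qed.

Lemma bianchi_proj_span Q : bianchi_proj Q - Q \in plucker_span K n.
Proof.
rewrite /bianchi_proj addrC addKr rpredN rpredZ // rpred_sum // => i _.
rewrite rpred_sum // => j _; rewrite rpredZ // memv_span //.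
by apply/fintype.imageP; exists ((pair1 i, pair2 i), (pair1 j, pair2 j)).
Qed.

End Polar.

(** * Nonzero polynomials have nonzero values in characteristic zero *)

Section Nonvanishing.

Lemma digits_inj (d n : nat) (f g : 'I_n -> nat) :
  (forall i, f i < d)%N -> (forall i, g i < d)%N ->
  (\sum_(i < n) f i * d ^ i = \sum_(i < n) g i * d ^ i)%N -> f =1 g.
Proof.
elim: n f g => [|n IH] f g ltf ltg; first by move=> _ [].
have shift (h : 'I_n.+1 -> nat) : (\sum_(i < n.+1) h i * d ^ i =
    (\sum_(i < n) h (lift ord0 i) * d ^ i) * d + h ord0)%N.
  rewrite big_ord_recl expn0 muln1 addnC big_distrl; congr (_ + _)%N.
  by apply: eq_bigr => i _; rewrite /= /bump /= add1n expnS mulnCA mulnC.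
rewrite !{}shift => eqfg.
have eq0 : f ord0 = g ord0.
  by have := congr1 (modn^~ d) eqfg; rewrite /= !modnMDl !modn_small.
have lt0d : (0 < d)%N by apply: leq_ltn_trans (ltf ord0).
have eqS : (\sum_(i < n) f (lift ord0 i) * d ^ i =
            \sum_(i < n) g (lift ord0 i) * d ^ i)%N.
  by move/eqP: eqfg; rewrite eq0 eqn_add2r eqn_pmul2r // => /eqP.
move=> i; case: (unliftP ord0 i) => [j ->|-> //].
exact: (IH (fun j => f (lift ord0 j)) (fun j => g (lift ord0 j))).
Qed.

Variables (K : fieldType) (n : nat).
Hypothesis charK : [pchar K] =i pred0.

(** The naturals below [size p] are distinct in [K] and outnumber the roots of [p]. *)
Lemma poly_nonroot (p : {poly K}) : p != 0 -> exists t, p.[t] != 0.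
Proof.
move=> nzp; pose s := [seq (k%:R : K) | k <- iota 0 (size p)].
have uniq_s : uniq s.
  rewrite map_inj_in_uniq ?iota_uniq // => i j _ _.
  wlog leij : i j / (i <= j)%N => [IH|eqij].
    by case/orP: (leq_total i j) => [/IH//|/IH] e /esym/e.
  have /eqP : (j - i)%:R = 0 :> K by rewrite natrB // eqij subrr.
  by rewrite ((pcharf0P _).1 charK) subn_eq0 => ?; apply/eqP; rewrite eqn_leq leij.
have [rt|/allPn[t _ nrt]] := boolP (all (root p) s); last by exists t.
by have := max_poly_roots nzp rt uniq_s; rewrite size_map size_iota ltnn.
Qed.

(* Kronecker's substitution u_i := t ^ (d ^ i), with d larger than every
   exponent, sends distinct monomials to distinct powers of t. *)
Lemma mpoly_nonroot (p : {mpoly K[n]}) : p != 0 -> exists u, p.@[u] != 0.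
Proof.
move=> nzp; pose d := msize p.
pose wt (m : 'X_{1..n}) := (\sum_(i < n) m i * d ^ i)%N.
have ltd m i : m \in msupp p -> (m i < d)%N.
  move=> /msize_mdeg_lt; apply: leq_ltn_trans.
  by rewrite mdegE (bigD1 i) //= leq_addr.
have wt_inj m m' : m \in msupp p -> m' \in msupp p -> wt m = wt m' -> m = m'.
  move=> mp m'p eqw; apply/mnmP; apply: digits_inj eqw => i; exact: ltd.
pose q : {poly K} := \sum_(m <- msupp p) p@_m *: 'X^(wt m).
have nzq : q != 0.
  have m0p := mlead_supp nzp.
  apply/eqP => /(congr1 (fun r : {poly K} => r`_(wt (mlead p)))).
  rewrite coef0 coef_sum (bigD1_seq _ m0p (msupp_uniq p)) /=.
  rewrite coefZ coefXn eqxx mulr1 big_seq_cond big1 ?addr0 => [|m /andP[mp nem]].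
    by apply/eqP; rewrite mleadc_eq0.
  rewrite coefZ coefXn; case: eqP => [/wt_inj e|]; last by rewrite mulr0.
  by rewrite e ?eqxx // in nem.
have [t nzt] := poly_nonroot nzq; exists (fun i => t ^+ (d ^ i)).
rewrite mevalE; apply: contraNneq nzt => p0; rewrite -p0 horner_sum.
apply/eqP; apply: eq_bigr => m _; rewrite hornerZ hornerXn -prodrXr; congr (_ * _).
by apply: eq_bigr => i _; rewrite -exprM mulnC.
Qed.

End Nonvanishing.

(** * Values and derivatives of the Monge metric; injectivity on Bianchi forms *)

Section Metric.
Variables (K : fieldType) (n : nat).
Implicit Types (a b c d p q r s : 'I_n.+1) (Q : 'M[K]_#|pairs n|).
Implicit Types (i j k l m : 'I_n) (u : 'I_n -> K).
Local Notation biv := (bivector K).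
Local Notation aff := (lift ord_max).

Let h u a : K := (hcoord K a).@[u].

Lemma hcoord_eval_max u : h u ord_max = 1.
Proof. by rewrite /h /hcoord unlift_none meval1. Qed.

Lemma hcoord_deriv a m : (hcoord K a)^`M(m) = ((a == aff m)%:R)%:MP.
Proof.
rewrite /hcoord; case: unliftP => [i ->|->].
  rewrite (inj_eq lift_inj) mderivX mnm1E; case: eqP => [->|_].
    have -> : (U_(m) - U_(m) = 0 :> 'X_{1..n})%MM by rewrite -[X in (X -
      _)%MM]add0m addmK.
    by rewrite mpolyX0 scale1r.
  by rewrite scale0r mpolyC0.
by rewrite -mpolyC1 mderivC (negbTE (neq_lift _ _)) mpolyC0.
Qed.

Lemma dhcoordE a m : dhcoord K a 0 m = ((a == aff m)%:R)%:MP.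
Proof.
rewrite /dhcoord; case: unliftP => [i ->|->].
  rewrite mxE (inj_eq lift_inj) eqxx eq_sym; case: eqP => _;
    by rewrite ?mpolyC1 ?mpolyC0.
by rewrite mxE (negbTE (neq_lift _ _)) mpolyC0.
Qed.

Lemma plucker_formE a b k : plucker_form K a b 0 k =
  hcoord K a * ((b == aff k)%:R)%:MP - hcoord K b * ((a == aff k)%:R)%:MP.
Proof. by rewrite !mxE !dhcoordE. Qed.

Let dualp (x : 'I_#|pairs n|) k := plucker_form K (pair1 x) (pair2 x) 0 k.

(** Collecting the coefficients of du^k in all p^ab gives the bivector u /\ e_k ([line_vecE]), which
    is affine in the chart coordinates. *)
Definition line_vec u k : 'rV[K]_#|pairs n| := \row_x (dualp x k).@[u].

Definition aff_bivector m k : 'rV[K]_#|pairs n| := biv (aff m) (aff k).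

Lemma dualp_deriv x k m : (dualp x k)^`M(m) = (aff_bivector m k 0 x)%:MP.
Proof.
rewrite /dualp plucker_formE mderivB !mderivM !mderivC !mulr0 !addr0 !hcoord_deriv.
by rewrite -!mpolyCM -mpolyCB mxE -!mulnb !natrM [X in _ - X]mulrC.
Qed.

Lemma line_vecE u k : line_vec u k = \sum_a h u a *: biv a (aff k).
Proof.
apply/rowP => x; rewrite mxE summxE /dualp plucker_formE mevalB !mevalM !mevalC.
under eq_bigr => a _ do rewrite !mxE mulrBr -!mulnb !natrM mulrA.
rewrite sumrB (bigD1 (pair1 x)) //= eqxx big1 ?addr0 => [|a nea]; last first.
  by rewrite eq_sym (negbTE nea) mulr0 mul0r.
rewrite (bigD1 (pair2 x)) //= eqxx big1 ?addr0 => [|a nea]; last first.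
  by rewrite [pair2 x == a]eq_sym (negbTE nea) !mulr0.
by rewrite !mulr1 /h; ring.
Qed.

Lemma monge_metricE Q k l : monge_metric Q k l =
  \sum_x \sum_y (Q x y)%:MP * (dualp x k * dualp y l).
Proof.
rewrite summxE; apply: eq_bigr => x _; rewrite summxE; apply: eq_bigr => y _.
by rewrite mxE [in LHS]mxE big_ord1 [_^T _ _]mxE.
Qed.

Lemma monge_eval Q k l u :
  (monge_metric Q k l).@[u] = bil Q (line_vec u k) (line_vec u l).
Proof.
rewrite monge_metricE raddf_sum bilE; apply: eq_bigr => x _.
rewrite raddf_sum; apply: eq_bigr => y _.
by rewrite /= !mevalM mevalC !mxE.
Qed.

Lemma monge_deriv Q k l m : (monge_metric Q k l)^`M(m) =
  \sum_x \sum_y (Q x y)%:MP *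
    ((aff_bivector m k 0 x)%:MP * dualp y l + dualp x k * (aff_bivector m l 0
      y)%:MP).
Proof.
rewrite monge_metricE raddf_sum; apply: eq_bigr => x _.
rewrite raddf_sum; apply: eq_bigr => y _.
by rewrite /= mderiv_mulC mderivM !dualp_deriv.
Qed.

Lemma monge_deriv_eval Q k l m u : (monge_metric Q k l)^`M(m).@[u] =
  bil Q (aff_bivector m k) (line_vec u l) + bil Q (line_vec u k) (aff_bivector m l).
Proof.
rewrite monge_deriv raddf_sum !bilE -big_split; apply: eq_bigr => x _.
rewrite raddf_sum -big_split; apply: eq_bigr => y _.
by rewrite /= mevalM mevalD !mevalM !mevalC -mulrDr [line_vec _ _ _ _]mxE
  [line_vec _ _ _ _]mxE.
Qed.

Lemma monge_deriv2_eval Q k l m m' u : (monge_metric Q k l)^`M(m)^`M(m').@[u] =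
  bil Q (aff_bivector m k) (aff_bivector m' l) + bil Q (aff_bivector m' k)
    (aff_bivector m l).
Proof.
rewrite monge_deriv (raddf_sum (mderiv m')) raddf_sum !bilE -big_split;
  apply: eq_bigr => x _.
rewrite (raddf_sum (mderiv m')) raddf_sum -big_split; apply: eq_bigr => y _.
rewrite /= mderiv_mulC mderivD !mderivM !mderivC !dualp_deriv mul0r mulr0 add0r
  addr0.
by rewrite mevalM mevalD !mevalM !mevalC -mulrDr.
Qed.

Lemma monge_metricD Q Q' : monge_metric (Q + Q') = monge_metric Q + monge_metric Q'.
Proof.
apply/matrixP => k l; rewrite [RHS]mxE !monge_metricE -big_split.
apply: eq_bigr => x _; rewrite -big_split; apply: eq_bigr => y _.
by rewrite mxE mpolyCD mulrDl.
Qed.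

Lemma monge_metricZ t Q : monge_metric (t *: Q) = t%:MP *: monge_metric Q.
Proof.
apply/matrixP => k l; rewrite [RHS]mxE !monge_metricE mulr_sumr.
apply: eq_bigr => x _; rewrite mulr_sumr; apply: eq_bigr => y _.
by rewrite mxE mpolyCM -mulrA.
Qed.

Lemma line_vec_dot u k p q : (line_vec u k *m (biv p q)^T) 0 0 =
  h u p * (aff k == q)%:R - h u q * (aff k == p)%:R.
Proof.
rewrite line_vecE mulmx_suml summxE.
under eq_bigr => a _ do rewrite -scalemxAl mxE bivector_dot mulrBr !mulrA.
rewrite sumrB (bigD1 p) //= eqxx big1 ?addr0 => [|a nea]; last first.
  by rewrite (negbTE nea) mulr0 mul0r.
rewrite (bigD1 q) //= eqxx big1 ?addr0 => [|a nea]; last first.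
  by rewrite (negbTE nea) mulr0 mul0r.
by rewrite !mulr1.
Qed.

(** The bivectors u /\ e_k and u /\ e_l share the factor u, so their wedge product vanishes, and a
    Plücker relation evaluates to a coordinate of that product up to a constant. Checking this at
    every point suffices by [mpoly_nonroot]. *)
Lemma monge_plucker_relation (charK : [pchar K] =i pred0) p q r s :
  monge_metric (plucker_relation K p q r s) = 0.
Proof.
apply/matrixP => k l; rewrite [RHS]mxE; apply/eqP; apply/negPn/negP.
case/(mpoly_nonroot charK) => u /negP; apply; rewrite monge_eval.
rewrite /plucker_relation !bilDm -[- sym_prod _ _]scaleN1r [bil (-1 *: _) _ _]bilZm.
by rewrite !bil_sym_prod !line_vec_dot; apply/eqP; ring.
Qed.

Lemma monge_plucker_span (charK : [pchar K] =i pred0) Q :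
  Q \in plucker_span K n -> monge_metric Q = 0.
Proof.
move/coord_span ->; apply: (big_ind (fun Q => monge_metric Q = 0)).
- by rewrite -[0](scale0r 0) monge_metricZ mpolyC0 scale0r.
- by move=> Q1 Q2 e1 e2; rewrite monge_metricD e1 e2 addr0.
move=> x _; rewrite monge_metricZ.
set X := _`_x; have /fintype.imageP[y _ ->] : X \in
    [seq plucker_relation K y.1.1 y.1.2 y.2.1 y.2.2
    | y : ('I_n.+1 * 'I_n.+1) * ('I_n.+1 * 'I_n.+1)].
  by rewrite mem_nth // size_tuple.
by rewrite monge_plucker_relation // scaler0.
Qed.

(** The derivatives of order 0, 1 and 2 at the origin control the blocks of [Q] in which [ord_max]
    occurs in both bivectors, in one, or in none. *)
Lemma monge_metric_inj0 Q : Q^T = Q -> bianchi Q -> 3%:R != 0 :> K ->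
  monge_metric Q = 0 -> Q = 0.
Proof.
move=> symQ bQ nz3 g0; pose o : 'I_n -> K := fun=> 0.
have triple (t : K) : t + t + t = 0 -> t = 0.
  move=> e; apply/eqP; have : t * 3%:R == 0 by rewrite -e; apply/eqP; ring.
  by rewrite mulf_eq0 (negbTE nz3) orbF.
have vec0 k : line_vec o k = biv ord_max (aff k).
  rewrite line_vecE (bigD1 ord_max) //= hcoord_eval_max scale1r big1 ?addr0 // => a.
  case: (unliftP ord_max a) => [i ->|->]; last by rewrite eqxx.
  by rewrite /h /hcoord liftK mevalXU scale0r.
have e0 k l : bil Q (biv ord_max (aff k)) (biv ord_max (aff l)) = 0.
  by rewrite -!vec0 -monge_eval g0 mxE meval0.
have e1 k l m : bil Q (aff_bivector m k) (biv ord_max (aff l)) =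
    - bil Q (biv ord_max (aff k)) (aff_bivector m l).
  apply/eqP; rewrite -addr_eq0 -!vec0 -monge_deriv_eval g0 mxE mderiv0 meval0 //.
have e2 k l m m' : bil Q (aff_bivector m k) (aff_bivector m' l) = - bil Q
  (aff_bivector m' k) (aff_bivector m l).
  by apply/eqP; rewrite -addr_eq0 -(monge_deriv2_eval _ _ _ _ _ o) g0 mxE
    !mderiv0 meval0.
have aff_bivectorN k m : aff_bivector m k = - aff_bivector k m by exact: bivectorN.
(* [T] is odd under both adjacent transpositions, so the three terms of its Bianchi sum coincide and
   3T = 0. *)
have e1' k l m : bil Q (aff_bivector m k) (biv ord_max (aff l)) = 0.
  pose T m k l := bil Q (aff_bivector m k) (biv ord_max (aff l)).
  have T12 m' k' l' : T m' k' l' = - T k' m' l' by rewrite /T aff_bivectorN bilNl.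
  have T23 m' k' l' : T m' k' l' = - T m' l' k' by rewrite /T e1 bilC.
  apply: triple; rewrite -[RHS](bQ ord_max (aff l) (aff m) (aff k)) /cyc.
  rewrite ![bil Q (biv ord_max _) _]bilC // -/(T m k l).
  congr (_ + _ + _); first by rewrite -[RHS]/(T k l m) T12 T23 opprK.
  by rewrite -[RHS]/(T l m k) T23 T12 opprK.
(* By [e2] and the antisymmetry of bivectors this is alternating in all four indices, so Bianchi
   again gives three equal terms. *)
have e2' k l m m' : bil Q (aff_bivector m k) (aff_bivector m' l) = 0.
  apply: triple; rewrite -[RHS](bQ (aff m) (aff k) (aff m') (aff l)) /cyc.
  congr (_ + _ + _).
    by rewrite -[RHS]/(bil Q (aff_bivector m m') (aff_bivector l k)) [RHS]e2
      [aff_bivector l m']aff_bivectorN bilNl opprK bilC.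
  by rewrite -[RHS]/(bil Q (aff_bivector m l) (aff_bivector k m'))
    [aff_bivector k m']aff_bivectorN bilNr [in RHS]e2 opprK bilC.
(* Index pairs are increasing, so only the second entry can be [ord_max]. *)
have nomax (x : 'I_#|pairs n|) : exists2 k, pair1 x = aff k &
    (exists l, pair2 x = aff l) \/ pair2 x = ord_max.
  case: (unliftP ord_max (pair1 x)) => [k ek|e1x]; last first.
    by have := pair_lt x; rewrite e1x ltnNge -ltnS ltn_ord.
  by exists k => //; case: (unliftP ord_max (pair2 x)) => [l ->|]; [left;
    exists l|right].
apply/matrixP => x y; rewrite [RHS]mxE.
have -> : Q x y = bil Q (biv (pair1 x) (pair2 x)) (biv (pair1 y) (pair2 y)).
  by rewrite !bivector_pair /bil -rowE trmx_delta -colE !mxE.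
have [k -> [[l ->]|->]] := nomax x; have [k' -> [[l' ->]|->]] := nomax y.
- exact: e2'.
- by rewrite [biv _ ord_max]bivectorN bilNr e1' oppr0.
- by rewrite [biv _ ord_max]bivectorN bilNl bilC // e1' oppr0.
by rewrite [biv (aff k) _]bivectorN [biv (aff k') _]bivectorN bilNl bilNr e0 !oppr0.
Qed.

End Metric.

(** * The Hamiltonian relations as a rank condition *)

Section Hamiltonian.
Variables (K : fieldType) (n : nat).
Hypothesis charK : [pchar K] =i pred0.
Implicit Types (Q : 'M[K]_#|pairs n|) (i j k l m : 'I_n) (u : 'I_n -> K).
Local Notation biv := (bivector K).
Local Notation aff := (lift ord_max).

Let nz (k : nat) : k.+1%:R != 0 :> K.
Proof. by rewrite ((pcharf0P _).1 charK). Qed.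

Definition line_mx u : 'M[K]_(n, #|pairs n|) := \matrix_k line_vec u k.

Definition gram Q u : 'M[K]_n := line_mx u *m Q *m (line_mx u)^T.

Lemma aff_bivectorN m k : aff_bivector K m k = - aff_bivector K k m.
Proof. exact: bivectorN. Qed.

Lemma gramE Q u : map_mx (meval u) (monge_metric Q) = gram Q u.
Proof.
apply/matrixP => k l; rewrite mxE monge_eval /bil /gram.
have rowL i : line_vec u i = row i (line_mx u) by rewrite rowK.
by rewrite !rowL -row_mul !mxE; apply: eq_bigr => x _; rewrite !mxE.
Qed.

Lemma det_monge_eval Q u : (\det (monge_metric Q)).@[u] = \det (gram Q u).
Proof. by rewrite -gramE det_map_mx. Qed.

(** The six terms cancel in pairs because e_k /\ e_i is odd in its indices. This yields the relation
    expressing the derivatives of g through c. *)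
Lemma monge_deriv_cycle Q i j k u : Q^T = Q ->
  (monge_metric Q i j)^`M(k).@[u] + (monge_metric Q j k)^`M(i).@[u]
  + (monge_metric Q k i)^`M(j).@[u] = 0.
Proof.
move=> symQ; rewrite !monge_deriv_eval ![bil Q (line_vec _ _) _]bilC //.
by rewrite (aff_bivectorN k i) (aff_bivectorN i j) (aff_bivectorN j k) !bilNl; ring.
Qed.

(** Expanding both derivatives gives 3c as three times the right side minus a cyclic sum, which is
    the Bianchi identity contracted with u. *)
Lemma metric_c_eval Q i k m u : Q^T = Q -> bianchi Q ->
  (metric_c (monge_metric Q) i k m).@[u] = bil Q (line_vec u i) (aff_bivector K
    k m).
Proof.
move=> symQ bQ; rewrite /metric_c mevalZ mevalB !monge_deriv_eval.
have cyc0 : bil Q (line_vec u i) (aff_bivector K k m) + bil Q (line_vec u k)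
  (aff_bivector K m i)
    + bil Q (line_vec u m) (aff_bivector K i k) = 0.
  rewrite !line_vecE !bil_suml -!big_split big1 // => a _ /=.
  by rewrite -!mulrDr [X in _ * X]bQ mulr0.
apply: (mulfI (nz 2)); rewrite mulVKf //.
rewrite (bilC (aff_bivector K k i)) // (bilC (aff_bivector K m i)) //
  (aff_bivectorN k i) (aff_bivectorN m k) !bilNr.
by rewrite -[RHS]subr0 -[X in _ = _ - X]cyc0; ring.
Qed.

Lemma metric_c_deriv_eval Q i k m l u : Q^T = Q -> bianchi Q ->
  (metric_c (monge_metric Q) i k m)^`M(l).@[u] = bil Q (aff_bivector K l i)
    (aff_bivector K k m).
Proof.
move=> symQ bQ; rewrite /metric_c mderivZ mderivB mevalZ mevalB !monge_deriv2_eval.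
have cyc0 : bil Q (aff_bivector K l i) (aff_bivector K k m) + bil Q
  (aff_bivector K l k) (aff_bivector K m i)
  + bil Q (aff_bivector K l m) (aff_bivector K i k) = 0 by exact: bQ.
apply: (mulfI (nz 2)); rewrite mulVKf //.
rewrite (bilC (aff_bivector K k i)) // (bilC (aff_bivector K m i)) //
  (aff_bivectorN k i) (aff_bivectorN m k) !bilNr.
by rewrite -[RHS]subr0 -[X in _ = _ - X]cyc0; ring.
Qed.

(* The affine bivectors and the psi_k(u) span: psi_k(u) is e_(n+1) /\ e_k up to
   affine bivectors. *)
Lemma line_span u (p : nat) (v : 'M[K]_(#|pairs n|, p)) :
  (forall m k, aff_bivector K m k *m v = 0) -> line_mx u *m v = 0 -> v = 0.
Proof.
move=> dir0 line0.
have vmax k : biv ord_max (aff k) *m v = 0.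
  have : row k (line_mx u *m v) = 0 by rewrite line0 row0.
  rewrite row_mul rowK line_vecE mulmx_suml (bigD1 ord_max) //= hcoord_eval_max
    scale1r.
  rewrite big1 ?addr0 // => a nea; case: (unliftP ord_max a) nea => [j ->|->];
    last by rewrite eqxx.
  by rewrite -scalemxAl dir0 scaler0.
apply/row_matrixP => x; rewrite row0 rowE -bivector_pair.
case: (unliftP ord_max (pair1 x)) => [k ->|->];
  case: (unliftP ord_max (pair2 x)) => [l ->|->].
- exact: dir0.
- by rewrite bivectorN mulNmx vmax oppr0.
- exact: vmax.
suff -> : biv ord_max ord_max = 0 :> 'rV_#|pairs n| by rewrite mul0mx.
by apply/rowP => y; rewrite !mxE subrr.
Qed.

(** The quadratic relation compares two forms on affine bivectors only. They agree anyway once one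
    argument is a [line_vec u k], and both kinds of bivectors together span ([line_span]). *)
Lemma hamiltonian_metricP Q : Q^T = Q -> bianchi Q ->
  hamiltonian_metric (monge_metric Q) <->
  forall u, \det (gram Q u) != 0 ->
    Q = Q *m (line_mx u)^T *m invmx (gram Q u) *m line_mx u *m Q.
Proof.
move=> symQ bQ.
(* Where the Gram matrix is invertible, [E u] is [Q] evaluated on orthogonal projections to the span
   of the [line_vec u k]. *)
pose E u := Q *m (line_mx u)^T *m invmx (gram Q u) *m line_mx u *m Q.
have bilE_line u x y : bil (E u) x y = \sum_p \sum_q
    invmx (gram Q u) p q * bil Q (line_vec u p) x * bil Q (line_vec u q) y.
  have -> : bil (E u) x y = ((x *m Q *m (line_mx u)^T) *m invmx (gram Q u)
      *m (line_mx u *m Q *m y^T)) 0 0 by rewrite /bil /E !mulmxA.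
  rewrite mxE exchange_big; apply: eq_bigr => q _;
    rewrite [X in X * _]mxE mulr_suml.
  apply: eq_bigr => p _; rewrite [in RHS]bilC //.
  have -> : bil Q x (line_vec u p) = (x *m Q *m (line_mx u)^T) 0 p.
    by rewrite /bil !mxE; apply: eq_bigr => z _; rewrite !mxE.
  have -> : bil Q (line_vec u q) y = (line_mx u *m Q *m y^T) q 0.
    by rewrite /bil -(rowK (line_vec u)) -!row_mul mxE.
  by ring.
have quad u m n' k l :
    (metric_c (monge_metric Q) m n' k)^`M(l).@[u] =
      - (\sum_p \sum_q invmx (map_mx (meval u) (monge_metric Q)) p q
          * (metric_c (monge_metric Q) p m l).@[u]
          * (metric_c (monge_metric Q) q n' k).@[u])
    <-> bil Q (aff_bivector K l m) (aff_bivector K n' k) = bil (E u)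
      (aff_bivector K l m) (aff_bivector K n' k).
  (* Turning e_l /\ e_m into e_m /\ e_l absorbs the minus sign of the quadratic relation. *)
  rewrite metric_c_deriv_eval // gramE (aff_bivectorN l m) [bil (E u) _ _]bilNl
    bilE_line.
  under eq_bigr => p _ do under eq_bigr => q _ do rewrite !metric_c_eval //.
  by [].
split=> [ham u detG|ham u]; last first.
  rewrite det_monge_eval => /ham eQ.
  have symg i j : monge_metric Q i j = monge_metric Q j i.
    rewrite !monge_metricE exchange_big; apply: eq_bigr => x _;
      apply: eq_bigr => y _.
    by rewrite -[in LHS]symQ mxE [X in _ * X]mulrC.
  split=> [i j|m p k|m p k|m p k|m n' k l]; first by rewrite symg.
  - have := monge_deriv_cycle m p k u symQ; rewrite /metric_c !(mevalZ, mevalB).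
    rewrite (symg p m) (symg k m) => cycle; apply: (mulfI (nz 2)).
    rewrite mulrBr mulrN !mulVKf //;
      by rewrite -[RHS]addr0 -[X in _ = _ + X]cycle; ring.
  - by rewrite /metric_c -mevalN -scalerN opprB.
  - by rewrite /metric_c (symg p m) (symg k m) (symg k p) -!mevalD -!scalerDr;
      rewrite [X in _ *: X](_ : _ = 0) ?scaler0 ?meval0 //; ring.
  by apply/quad; rewrite -[E u]eQ.
have unitG : gram Q u \in unitmx by rewrite unitmxE unitfE.
apply/eqP; rewrite -subr_eq0 -/(E u); apply/eqP.
have line0 : line_mx u *m (Q - E u) = 0.
  rewrite mulmxBr /E !mulmxA -/(gram Q u) mulmxV // mul1mx subrr //.
have line0r : (Q - E u) *m (line_mx u)^T = 0.
  rewrite mulmxBl /E -!mulmxA (mulmxA (line_mx u)) -/(gram Q u) mulVmx //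
    mulmx1 subrr //.
(* Spanning is used twice, once for each argument of the form [Q - E u]. *)
apply: (line_span _ line0) => m k; apply: trmx_inj; rewrite linear0.
apply: (@line_span u) => [l j|]; last first.
  by apply: trmx_inj; rewrite trmx_mul trmxK -mulmxA line0r mulmx0 linear0.
have eQE : bil Q (aff_bivector K m k) (aff_bivector K l j) = bil (E u)
  (aff_bivector K m k) (aff_bivector K l j).
  by apply/quad; have [|_ _ _ _ ] := ham u; rewrite ?det_monge_eval.
apply: trmx_inj; rewrite trmx_mul trmxK linear0 mulmxBr mulmxBl.
apply/matrixP => x y; rewrite !ord1 mxE [X in _ + X]mxE [RHS]mxE.
by apply/eqP; rewrite subr_eq0; apply/eqP.
Qed.

(** An invertible G = P Q P^T forces rank at least r, for [Q] and for P Q. If [Q] has rank r, its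
    rows lie in the row space of P Q, so Q = X P Q; multiplying by P^T gives X = Q P^T G^-1.
    Conversely the formula factors [Q] through dimension r. *)
Lemma rank_gram (N r : nat) (Q : 'M[K]_N) (P : 'M[K]_(r, N)) :
  \det (P *m Q *m P^T) != 0 ->
  \rank Q = r <-> Q = Q *m P^T *m invmx (P *m Q *m P^T) *m P *m Q.
Proof.
set G := P *m Q *m P^T => detG.
have unitG : G \in unitmx by rewrite unitmxE unitfE.
have rG : \rank G = r by exact: mxrank_unit.
split=> [rQ|eQ]; last first.
  apply/eqP; rewrite eqn_leq; apply/andP; split.
    rewrite {1}eQ -!mulmxA mulmxA (leq_trans (mxrankM_maxr _ _)) //.
    exact: leq_trans (mxrankM_maxl _ _) (rank_leq_row _).
  rewrite -{1}rG /G -mulmxA (leq_trans (mxrankM_maxr _ _)) //.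
  exact: mxrankM_maxl.
have /submxP[X eX] : (Q <= P *m Q)%MS.
  rewrite -(geq_leqif (mxrank_leqif_sup (submxMl P Q))) rQ -{1}rG.
  exact: mxrankM_maxl.
have -> : Q *m P^T *m invmx G = X; last by rewrite -mulmxA.
by rewrite {1}eX -(mulmxA X) -/G mulmxK.
Qed.

(** The rank gives the relation at every nondegenerate point, and the relation at a single such
    point gives back the rank; [mpoly_nonroot] provides the point. *)
Lemma rank_hamiltonian Q : Q^T = Q -> bianchi Q -> \det (monge_metric Q) != 0 ->
  \rank Q = n <-> hamiltonian_metric (monge_metric Q).
Proof.
move=> symQ bQ detg; rewrite hamiltonian_metricP //; split=> [rQ u detG|ham].
  exact: (rank_gram detG).1.
have [u] := mpoly_nonroot charK detg; rewrite det_monge_eval => detG.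
by apply/(rank_gram detG); exact: ham.
Qed.

(** * The two bijections *)

Lemma bianchi_monge_inj Q Q' : Q^T = Q -> Q'^T = Q' -> bianchi Q -> bianchi Q' ->
  monge_metric Q = monge_metric Q' -> Q = Q'.
Proof.
move=> symQ symQ' bQ bQ' eqg; apply/eqP; rewrite -subr_eq0 -scaleN1r; apply/eqP.
apply: monge_metric_inj0 (nz 2) _.
- by rewrite linearD linearZ /= symQ symQ'.
- by move=> a b c d; rewrite cycD cycZ bQ bQ' mulr0 addr0.
by rewrite monge_metricD monge_metricZ eqg -{1}[monge_metric Q']scale1r -mpolyC1
  -scalerDl -mpolyCD subrr mpolyC0 scale0r.
Qed.

Lemma nondeg_wedge_kernelP Q : nondeg_wedge_kernel_rank_n Q <->
  [/\ Q^T = Q, bianchi Q, \det (monge_metric Q) != 0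
    & hamiltonian_metric (monge_metric Q)].
Proof.
split=> [[symQ rQ /(wedge_map_eq0 symQ (nz 1)) bQ detg]|[symQ bQ detg ham]].
  by split => //; apply/rank_hamiltonian.
split => //; first by apply/rank_hamiltonian.
exact/(wedge_map_eq0 symQ (nz 1)).
Qed.

Lemma monge_bianchi_proj Q : monge_metric (bianchi_proj Q) = monge_metric Q.
Proof.
rewrite -[in LHS](subrK Q (bianchi_proj Q)) monge_metricD.
by rewrite (monge_plucker_span charK (bianchi_proj_span Q)) add0r.
Qed.

Lemma line_complex_eq Q Q' : Q - Q' \in plucker_span K n ->
  line_complex Q = line_complex Q'.
Proof.
move=> dQ; apply/seteqP; split=> P [symP dP]; split=> //.
  by rewrite -(subrKA Q) rpredD.
by rewrite -(subrKA Q') rpredD // -opprB rpredN.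
Qed.

Lemma monge_metric_bij : set_bij (@nondeg_wedge_kernel_rank_n K n)
  (@hamiltonian_monge_metrics K n) (@monge_metric K n).
Proof.
split=> [Q|Q Q'|g].
- by case/nondeg_wedge_kernelP => symQ bQ detg ham; split=> //; exists Q.
- move=> /set_mem/nondeg_wedge_kernelP[symQ bQ _ _].
  move=> /set_mem/nondeg_wedge_kernelP[symQ' bQ' _ _]; exact: bianchi_monge_inj.
(* An arbitrary representative is traded for the Bianchi one with the same metric. *)
case=> -[Q symQ ->] detg ham; exists (bianchi_proj Q);
  last exact: monge_bianchi_proj.
apply/nondeg_wedge_kernelP; rewrite monge_bianchi_proj; split=> //.
  exact: bianchi_proj_tr.
exact: bianchi_projP.
Qed.

(** Equal complexes have equal metrics, so injectivity is inherited from Bianchi forms and their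
    metrics. *)
Lemma line_complex_bij : set_bij (@nondeg_wedge_kernel_rank_n K n)
  (@hamiltonian_line_complexes K n) (@line_complex K n).
Proof.
split=> [Q|Q Q'|C].
- by case/nondeg_wedge_kernelP => symQ bQ detg ham; exists Q.
- move=> /set_mem/nondeg_wedge_kernelP[symQ bQ _ _].
  move=> /set_mem/nondeg_wedge_kernelP[symQ' bQ' _ _] eqC.
  have [_ /(monge_plucker_span charK)] : line_complex Q' Q.
    by rewrite -eqC; split=> //; rewrite subrr mem0v.
  move=> dg; apply: bianchi_monge_inj => //.
  by rewrite -[in LHS](subrK Q' Q) monge_metricD dg add0r.
case=> Q [symQ -> detg ham]; exists (bianchi_proj Q); last first.
  exact/line_complex_eq/bianchi_proj_span.
apply/nondeg_wedge_kernelP; rewrite monge_bianchi_proj; split=> //.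
  exact: bianchi_proj_tr.
exact: bianchi_projP.
Qed.

End Hamiltonian.

Theorem theorem4p2 (R : realType) (n : nat) (hn : (1 <= n)%N) :
  (set_bij (@nondeg_wedge_kernel_rank_n R n) (@hamiltonian_monge_metrics R n)
     (@monge_metric R n) /\
   set_bij (@nondeg_wedge_kernel_rank_n R n) (@hamiltonian_line_complexes R n)
     (@line_complex R n)) /\
  (set_bij (@nondeg_wedge_kernel_rank_n R[i] n) (@hamiltonian_monge_metrics R[i] n)
     (@monge_metric R[i] n) /\
   set_bij (@nondeg_wedge_kernel_rank_n R[i] n) (@hamiltonian_line_complexes R[i] n)
     (@line_complex R[i] n)).
Proof.
have charR := Num.Theory.pchar_num R; have charC := Num.Theory.pchar_num R[i].
split; split; first [exact: monge_metric_bij | exact: line_complex_bij].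
Qed.
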